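(* Let $a>0$ be fixed, $\mu\in\mathbb{R}$, and let $f$ be the probability density on $\mathbb{R}$ $$f(x)=\frac{(1+x^2)^{-\frac{1}{2a}-1}\exp\left\{\frac{\mu}{a}\arctan x\right\}}{\int_{-\infty}^{+\infty}(1+y^2)^{-\frac{1}{2a}-1}\exp\left\{\frac{\mu}{a}\arctan y\right\}\,dy},$$ which is the invariant density of the Pearson diffusion $dX_t=-\theta(X_t-\mu)\,dt+\sqrt{2\theta a(X_t^2+1)}\,dW_t$, $\theta>0$. Then, for $m=1,2,\ldots$, the Rényi information of $f$ of order $\alpha=\frac{2a(m+1)}{1+2a}$ or $\alpha=\frac{2a(m+3/2)}{1+2a}$ (with $\alpha\neq 1$) is given respectively by the following formulas. (i) For $\alpha=\frac{2a(m+1)}{1+2a}$, $$\mathcal{R}_{\frac{2a(m+1)}{1+2a}}(f)=\frac{2a(m+1)}{2am-1}\log\int_{-\pi/2}^{\pi/2}(\cos x)^{\frac1a}\exp\left(-\frac{\mu}{a}x\right)dx+\frac{1+2a}{1-2am}\log\left(C(m,\mu)\sinh\left(\frac{(m+1)\mu}{1+2a}\pi\right)\right),$$ where $$C(m,\mu)=\frac{2\,(2m)!}{\frac{2(m+1)\mu}{1+2a}\prod_{k=1}^{m}\left(\left(\frac{2(m+1)\mu}{1+2a}\right)^2+(2k)^2\right)}.$$ (ii) For $\alpha=\frac{2a(m+3/2)}{1+2a}$, $$\mathcal{R}_{\frac{2a(m+3/2)}{1+2a}}(f)=\frac{a(2m+3)}{a(2m+1)-1}\log\int_{-\pi/2}^{\pi/2}(\cos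 x)^{\frac1a}\exp\left(-\frac{\mu}{a}x\right)dx+\frac{1+2a}{1-a(2m+1)}\log\left(D(m,\mu)\cosh\left(\frac{(2m+3)\mu}{2(1+2a)}\pi\right)\right),$$ where $$D(m,\mu)=\frac{2\,(2m+1)!}{\prod_{k=0}^{m}\left(\left(\frac{(2m+3)\mu}{1+2a}\right)^2+(2k+1)^2\right)}.$$
   Context: For a probability density $f$ on $\mathbb{R}$ and $\alpha>0$, $\alpha\neq1$, the Rényi information of order $\alpha$ is $$\mathcal R_\alpha(f)=\frac{1}{1-\alpha}\log\int_{-\infty}^{+\infty} f^\alpha(x)\,dx,$$ with $\log$ the natural logarithm. $W_t$ is a standard Wiener process. The invariant density of an ergodic diffusion $dX_t=b(X_t)\,dt+\sigma(X_t)\,dW_t$ on $(l,r)$ is $f(x)=m(x)/\int_l^r m(y)\,dy$, where $m(x)=1/(\sigma^2(x)s(x))$ and $s(x)=\exp\{-2\int_{\tilde x}^x b(y)/\sigma^2(y)\,dy\}$ for a fixed $\tilde x\in(l,r)$; here $f$ is given explicitly in the claim.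
   Formalization: In (i) the formula is undefined (0/0) at μ=0, since C(m,μ) has μ as a factor of its denominator; it is stated literally for μ≠0, and for μ=0 the product C(m,μ)·sinh(...) is replaced by its limit as μ→0, whose existence is also proved. *)

(* Defs.v *)
From HB Require Import structures.
From mathcomp Require Import all_boot all_order all_algebra.
From mathcomp Require Import all_classical all_reals all_analysis.

Set Implicit Arguments.
Unset Strict Implicit.
Unset Printing Implicit Defensive.

Import Order.TTheory GRing.Theory Num.Theory.
Import numFieldNormedType.Exports.

Local Open Scope classical_set_scope.
Local Open Scope ring_scope.

Section hyperbolic.
Context {R : realType}.

Definition sinh (x : R) : R := (expR x - expR (- x)) / 2.

Definition cosh (x : R) : R := (expR x + expR (- x)) / 2.

End hyperbolic.

Section renyi.
Context {R : realType}.
Local Notation leb := (@lebesgue_measure R).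

Definition is_density (f : R -> R) : Prop :=
  [/\ measurable_fun setT f, (forall x, 0 <= f x) &
      (\int[leb]_x (f x)%:E = 1)%E].

(* The value is an extended real because the integral may be infinite, or zero
   only if f vanishes almost everywhere; an equality with [r%:E] therefore
   includes the finiteness and positivity of the integral. *)
Definition renyi (alpha : R) (f : R -> R) : \bar R :=
  (((1 - alpha)^-1)%:E * lne (\int[leb]_x (f x `^ alpha)%:E))%E.

End renyi.

Section diffusion.
Context {R : realType}.
Local Notation leb := (@lebesgue_measure R).

Definition oriented_integral (x0 x : R) (g : R -> R) : R :=
  if x0 <= x then \int[leb]_(y in `[x0, x]) g y
  else - \int[leb]_(y in `[x, x0]) g y.

Variables (l r : \bar R) (b sigma : R -> R) (x0 : R).

Definition scale_density (x : R) : R :=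
  expR (- 2 * oriented_integral x0 x (fun y => b y / sigma y ^+ 2)).

Definition speed_density (x : R) : R :=
  (sigma x ^+ 2 * scale_density x)^-1.

Definition invariant_density (x : R) : R :=
  speed_density x /
  \int[leb]_(y in [set y : R | (l < y%:E < r)%E]) speed_density y.

End diffusion.

Section pearson.
Context {R : realType}.
Local Notation leb := (@lebesgue_measure R).

Definition pearson_drift (theta mu x : R) : R := - theta * (x - mu).

Definition pearson_diffusion (theta a x : R) : R :=
  Num.sqrt (2 * theta * a * (x ^+ 2 + 1)).

Definition pearson_kernel (a mu x : R) : R :=
  ((1 + x ^+ 2) `^ (- (2 * a)^-1 - 1)) * expR (mu / a * atan x).

Definition pearson_density (a mu x : R) : R :=
  pearson_kernel a mu x / \int[leb]_(y in setT) pearson_kernel a mu y.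

Definition cos_exp_integral (a mu : R) : R :=
  \int[leb]_(x in `[- (pi / 2), pi / 2]) (cos x `^ a^-1 * expR (- (mu / a) * x)).

(* For mu = 0 the denominator is 0: the formula has no value there. *)
Definition coefC (a : R) (m : nat) (mu : R) : R :=
  let beta := 2 * (m%:R + 1) * mu / (1 + 2 * a) in
  2 * ((2 * m)`!)%:R /
  (beta * \prod_(1 <= k < m.+1) (beta ^+ 2 + (2 * k%:R) ^+ 2)).

Definition coefD (a : R) (m : nat) (mu : R) : R :=
  let beta := (2 * m%:R + 3) * mu / (1 + 2 * a) in
  2 * ((2 * m + 1)`!)%:R /
  \prod_(0 <= k < m.+1) (beta ^+ 2 + (2 * k%:R + 1) ^+ 2).

Definition C_sinh (a : R) (m : nat) (mu : R) : R :=
  coefC a m mu * sinh ((m%:R + 1) * mu / (1 + 2 * a) * pi).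

Definition D_cosh (a : R) (m : nat) (mu : R) : R :=
  coefD a m mu * cosh ((2 * m%:R + 3) * mu / (2 * (1 + 2 * a)) * pi).

End pearson.

(* Main.v *)
(* The substitution x = tan t turns the integral over the line of
   (1 + x^2)^(- r / 2 - 1) exp (c atan x) into the integral of cos^r t exp (c t)
   over [- pi / 2, pi / 2]. Both the normalizing constant of f (r = 1 / a) and the
   integral of f^alpha (r = 2m or r = 2m + 1 for the two values of alpha) are of
   this form. For an integer exponent, integrating by parts twice gives
   (b^2 + n^2) I_n = n (n - 1) I_(n - 2) for I_n = int cos^n t exp (b t) dt, hence
   the closed forms in terms of I_0 (sinh) and I_1 (cosh). *)
Require Import Defs.
From HB Require Import structures.
From mathcomp Require Import all_boot all_order all_algebra.
From mathcomp Require Import ring lra.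
From mathcomp Require Import all_classical all_reals all_analysis.
From mathcomp Require Import measurable_realfun.

Set Implicit Arguments.
Unset Strict Implicit.
Unset Printing Implicit Defensive.

Import Order.TTheory GRing.Theory Num.Theory.
Import numFieldNormedType.Exports.

Local Open Scope classical_set_scope.
Local Open Scope ring_scope.

Local Notation leb := lebesgue_measure.

(** * Integrals of continuous functions over segments and over the line *)

Lemma is_derive_continuous (R : realType) (F f : R -> R) :
  (forall x : R, is_derive x 1 F (f x)) -> continuous F.
Proof.
move=> dF x; apply/differentiable_continuous/derivable1_diffP.
by have [] := dF x.
Qed.

Lemma continuous_Rintegral_itv (R : realType) (F f : R -> R) (a b : R) :
  a <= b -> continuous f -> (forall x : R, is_derive x 1 F (f x)) ->
  \int[leb]_(x in `[a, b]) f x = F b - F a.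
Proof.
rewrite le_eqVlt => /predU1P[<- _ _|ab cf dF].
  by rewrite set_itv1 Rintegral_set1 subrr.
have cF := is_derive_continuous dF.
rewrite /Rintegral (@continuous_FTC2 _ f F)//.
- exact: continuous_subspaceT.
- split; first by move=> x _; have [] := dF x.
  + exact/cvg_at_right_filter/cF.
  + exact/cvg_at_left_filter/cF.
- by move=> x _; rewrite derive1E; apply: (@derive_val _ _ _ _ _ _ _ (dF x)).
Qed.

Lemma continuous_integrable_itv (R : realType) (f : R -> R) (a b : R) :
  continuous f -> leb.-integrable `[a, b] (EFin \o f).
Proof.
move=> cf; apply: continuous_compact_integrable; first exact: segment_compact.
exact: continuous_subspaceT.
Qed.

Lemma continuous_integral_itv (R : realType) (f : R -> R) (a b : R) :
  continuous f ->
  (\int[leb]_(x in `[a, b]) (f x)%:E)%E = (\int[leb]_(x in `[a, b]) f x)%:E.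
Proof.
move=> cf; rewrite fineK//; apply: integrable_fin_num => //.
exact: continuous_integrable_itv.
Qed.

Lemma continuous_measurable_EFin (R : realType) (f : R -> R) (D : set R) :
  continuous f -> measurable_fun D (EFin \o f).
Proof.
move=> cf; apply/measurable_EFinP; apply: measurable_funTS.
exact: continuous_measurable_fun.
Qed.

(** Reflecting the negative half-line leaves only integrals over a half-line, where the improper
    fundamental theorem of calculus applies. *)
Lemma ge0_integralT_halves (R : realType) (f : R -> R) :
  continuous f -> (forall x, 0 <= f x) ->
  (\int[leb]_x (f x)%:E =
   \int[leb]_(x in `[0%R, +oo[) (f (- x))%:E +
   \int[leb]_(x in `[0%R, +oo[) (f x)%:E)%E.
Proof.
move=> cf f0.
rewrite -(set_itvNyy R) (@itv_bndbnd_setU _ _ -oo%O (BLeft (0:R)) +oo%O)//.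
rewrite ge0_integral_setU//=; last 3 first.
- exact: continuous_measurable_EFin.
- by move=> x _; rewrite lee_fin.
- apply/disj_setPS => x /=; rewrite !in_itv/= andbT => -[].
  by rewrite ltNge => /negP.
congr (_ + _)%E.
rewrite integral_itv_bndo_bndc; last exact: continuous_measurable_EFin.
rewrite -{1}oppr0 (@ge0_integration_by_substitutionNy _ f)//.
exact: continuous_subspaceT.
Qed.

(** * The substitution x = tan t *)

Lemma continuous_inv1Dsqr (R : realType) :
  continuous (fun x : R => (1 + x ^+ 2)^-1).
Proof. exact: continuous_oneDsqrV. Qed.

Lemma continuous_comp_atan (R : realType) (g : R -> R) :
  continuous g -> continuous (fun x => g (atan x) * (1 + x ^+ 2)^-1).
Proof.
move=> cg x; apply: cvgM; last exact: continuous_inv1Dsqr.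
by apply: (@continuous_comp _ _ _ atan g); [exact: continuous_atan|exact: cg].
Qed.

(** If [F] is a primitive of [g], then [F \o atan] is a primitive of the left integrand and tends to
    [F (pi / 2)] at infinity. *)
Lemma ge0_integral_atan_itvcy (R : realType) (g : R -> R) :
  continuous g -> (forall x, 0 <= g x) ->
  (\int[leb]_(x in `[0%R, +oo[) (g (atan x) * (1 + x ^+ 2)^-1)%:E =
   \int[leb]_(x in `[0%R, (pi / 2)%R]) (g x)%:E)%E.
Proof.
move=> cg g0.
have pi0 : 0 < pi / 2 :> R by rewrite divr_gt0 ?pi_gt0.
(* The base point -1 lies strictly below 0 = atan 0, so that [F] is differentiable at 0 as well. *)
pose F (y : R) := \int[leb]_(t in `[-1, y]) g t.
have dF (y : R) : -1 < y -> is_derive y 1 F (g y).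
  move=> y1; have [] := @continuous_FTC1_closed R g (-1) y (y + 1) _
    (continuous_integrable_itv _ _ cg) y1 (cg y); first by rewrite ltrDl.
  by move=> dF <-; rewrite derive1E; apply: DeriveDef.
have cF (y : R) : -1 < y -> {for y, continuous F}.
  by move=> /dF[dFy _]; exact/differentiable_continuous/derivable1_diffP.
have atan0x (x : R) : 0 <= x -> -1 < atan x.
  by move=> x0; rewrite (@lt_le_trans _ _ 0)// -atan0 le_atan.
have dFa (x : R) : 0 <= x ->
    is_derive x 1 (F \o atan) (g (atan x) * (1 + x ^+ 2)^-1).
  by move=> x0; apply: is_derive1_comp; exact/dF/atan0x.
rewrite (@ge0_continuous_FTC2y R _ (F \o atan) 0 (F (pi / 2)))//=.
- rewrite atan0 -EFinB continuous_integral_itv//; congr EFin.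
  have := @Rintegral_itvB R g (BLeft (-1)) (BRight (pi / 2)) 0
    (continuous_integrable_itv _ _ cg).
  rewrite !bnd_simp lerN10 (ltW pi0) => ->//.
  rewrite Rintegral_itv_obnd_cbnd//.
  apply: (@integrableS _ _ _ leb `[0, pi / 2]) => //.
    by apply: subset_itv; rewrite bnd_simp.
  exact: continuous_integrable_itv.
- by move=> x _; rewrite mulr_ge0// invr_ge0 addr_ge0// sqr_ge0.
- exact/continuous_subspaceT/continuous_comp_atan.
- by apply: (cvg_comp _ _ (@cvgy_atan R)); apply: cF; rewrite (@lt_trans _ _ 0).
- by move=> x /ltW/dFa[].
- apply: cvg_at_right_filter.
  have [+ _] := dFa 0 (lexx 0).
  by move=> /derivable1_diffP/differentiable_continuous.
- move=> x; rewrite in_itv/= andbT => /ltW/dFa d.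
  by rewrite derive1E; apply: (@derive_val _ _ _ _ _ _ _ d).
Qed.

Lemma integral_itv_reflect (R : realType) (g : R -> R) (b : R) :
  0 <= b -> continuous g ->
  (\int[leb]_(x in `[(- b)%R, b]) (g (- x))%:E =
   \int[leb]_(x in `[(- b)%R, b]) (g x)%:E)%E.
Proof.
move=> b0 cg; have := @integration_by_substitution_oppr R g (- b) b.
rewrite opprK => <-//; first by rewrite ge0_cp.
exact: continuous_subspaceT.
Qed.

Lemma ge0_integral_atan (R : realType) (g : R -> R) :
  continuous g -> (forall x, 0 <= g x) ->
  (\int[leb]_x (g (atan x) * (1 + x ^+ 2)^-1)%:E =
   \int[leb]_(x in `[(- (pi / 2))%R, (pi / 2)%R]) (g x)%:E)%E.
Proof.
move=> cg g0.
have pi0 : 0 < pi / 2 :> R by rewrite divr_gt0 ?pi_gt0.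
rewrite ge0_integralT_halves; last 2 first.
- exact: continuous_comp_atan.
- by move=> x; rewrite mulr_ge0// invr_ge0 addr_ge0// sqr_ge0.
under eq_integral do rewrite atanN sqrrN.
have cgN : continuous (g \o -%R).
  by move=> x; apply: continuous_comp; [exact: continuousN|exact: cg].
have /= -> := @ge0_integral_atan_itvcy R (g \o -%R) cgN (fun x => g0 (- x)).
rewrite ge0_integral_atan_itvcy//.
(* The reflected half is turned back into an integral over [- pi / 2, 0]; the endpoint 0 is then
   dropped to make the two pieces disjoint. *)
have := @integration_by_substitution_oppr R g 0 (pi / 2) (ltW pi0).
rewrite oppr0 => <-; last exact: continuous_subspaceT.
rewrite -(@integral_itv_bndo_bndc _ (BLeft (- (pi / 2))) 0); last first.
  exact: continuous_measurable_EFin.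
rewrite [in RHS](@itv_bndbnd_setU _ _ _ (BLeft (0:R)))//; last 2 first.
- by rewrite bnd_simp oppr_le0 ltW.
- by rewrite bnd_simp ltW.
rewrite ge0_integral_setU//=.
- exact: continuous_measurable_EFin.
- by move=> x _; rewrite lee_fin.
- apply/disj_setPS => x /=; rewrite !in_itv/= => -[/andP[_]].
  by rewrite ltNge => /negP + /andP[].
Qed.

(** * Trigonometric moments with a real exponent *)

Lemma continuous_maxr0_powR (R : realType) (q : R) :
  0 < q -> continuous (fun y : R => Num.max y 0 `^ q).
Proof.
move=> q0 y; have [y0|y0|->] := ltrgt0P y.
- have cy : {for y, continuous (fun z : R => z `^ q)}.
    apply/differentiable_continuous/derivable1_diffP.
    by apply: derivable_powR; rewrite in_itv/= y0.
  rewrite /continuous_at max_l ?ltW//; apply: cvg_trans cy.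
  apply: near_eq_cvg; near=> z.
  by rewrite max_l// ltW//; near: z; exact: lt_nbhsr.
- apply: (@near_cst_continuous _ _ 0); near=> z.
  rewrite max_r ?powR0 ?gt_eqF// ltW//; near: z; exact: lt_nbhsl.
(* At 0 the function vanishes identically on the left, and on the right it is a positive power
   tending to 0. *)
- apply/left_right_continuousP; rewrite /= maxxx powR0 ?gt_eqF//; split.
    apply: cvg_near_cst; near=> z.
    by rewrite max_r ?powR0 ?gt_eqF// ltW//; near: z; exact: nbhs_left_lt.
  apply: cvg_trans (powR_cvg0 q0); apply: near_eq_cvg; near=> z.
  by rewrite max_l// ltW//; near: z; exact: nbhs_right_gt.
Unshelve. all: by end_near. Qed.

Lemma cos_atan_powR (R : realType) (r x : R) :
  cos (atan x) `^ r = (1 + x ^+ 2) `^ (- (r / 2)).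
Proof.
have x1 : 0 <= 1 + x ^+ 2 by rewrite addr_ge0// sqr_ge0.
rewrite cos_atan -powR12_sqrt// -powRN -powRrM; congr (_ `^ _).
by field.
Qed.

Definition trig_moment (R : realType) (r c : R) : R :=
  \int[leb]_(x in `[- (pi / 2), pi / 2]) (cos x `^ r * expR (c * x)).

(* Truncating the cosine at 0 makes the integrand continuous on the whole line
   without changing it on [- pi / 2, pi / 2]. *)
Definition trig_weight (R : realType) (r c x : R) : R :=
  Num.max (cos x) 0 `^ r * expR (c * x).

Lemma trig_weight_ge0 (R : realType) (r c x : R) : 0 <= trig_weight r c x.
Proof. by rewrite mulr_ge0 ?powR_ge0 ?expR_ge0. Qed.

Lemma continuous_expRZ (R : realType) (c : R) :
  continuous (fun x : R => expR (c * x)).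
Proof.
move=> x; apply: (@continuous_comp _ _ _ ( *%R c) expR).
  exact: mulrl_continuous.
exact: continuous_expR.
Qed.

Lemma continuous_trig_weight (R : realType) (r c : R) :
  0 < r -> continuous (trig_weight r c).
Proof.
move=> r0 x; apply: cvgM; last exact: continuous_expRZ.
apply: (@continuous_comp _ _ _ cos (fun y => Num.max y 0 `^ r)).
  exact: continuous_cos.
exact: continuous_maxr0_powR.
Qed.

Lemma trig_weightE (R : realType) (r c x : R) :
  x \in `[- (pi / 2), pi / 2] ->
  trig_weight r c x = cos x `^ r * expR (c * x).
Proof.
rewrite in_itv/= => xpi.
by rewrite /trig_weight max_l// cos_ge0_pihalf.
Qed.

Lemma trig_moment_weight (R : realType) (r c : R) :
  trig_moment r c =
  \int[leb]_(x in `[- (pi / 2), pi / 2]) trig_weight r c x.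
Proof.
by apply: eq_Rintegral => x /[!inE]/= xpi; rewrite trig_weightE.
Qed.

(** In the exponent, - 1 accounts for the derivative of [atan], and - r / 2 for the power [r] of cos
    (atan x) = (1 + x^2)^(- 1 / 2). *)
Lemma powR_expR_atanE (R : realType) (r c x : R) :
  (1 + x ^+ 2) `^ (- (r / 2) - 1) * expR (c * atan x) =
  trig_weight r c (atan x) * (1 + x ^+ 2)^-1.
Proof.
have x1 : 0 < 1 + x ^+ 2 by rewrite ltr_pwDl// sqr_ge0.
rewrite trig_weightE; last by rewrite in_itv/= !ltW ?atan_gtNpi2 ?atan_ltpi2.
rewrite cos_atan_powR powRD; last by rewrite [1 + _ == 0]gt_eqF// implybT.
by rewrite powR_inv1 ?ltW// mulrAC.
Qed.

Lemma integral_powR_expR_atan (R : realType) (r c : R) : 0 < r ->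
  (\int[leb]_x ((1 + x ^+ 2) `^ (- (r / 2) - 1) * expR (c * atan x))%:E =
   (trig_moment r c)%:E)%E.
Proof.
move=> r0; have cw := @continuous_trig_weight R r c r0.
rewrite trig_moment_weight -continuous_integral_itv//.
rewrite -ge0_integral_atan//; last exact: trig_weight_ge0.
by under eq_integral do rewrite powR_expR_atanE.
Qed.

(** The cosine is even. This reconciles exp (- mu x / a) in [cos_exp_integral] with exp (mu x / a),
    which the substitution produces. *)
Lemma trig_momentN (R : realType) (r c : R) : 0 < r ->
  trig_moment r (- c) = trig_moment r c.
Proof.
move=> r0; rewrite !trig_moment_weight /Rintegral; congr fine.
rewrite -[RHS]integral_itv_reflect ?divr_ge0 ?pi_ge0//; last first.
  exact: continuous_trig_weight.
by apply: eq_integral => x _; rewrite /trig_weight cosN mulrN mulNr.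
Qed.

(** * Closed forms of the moments with an integer exponent *)

Section moments.
Context {R : realType}.
Implicit Types (b x : R) (n : nat).

Definition cos_moment n b : R :=
  \int[leb]_(x in `[- (pi / 2), pi / 2]) (cos x ^+ n * expR (b * x)).

Let W n b x := cos x ^+ n * expR (b * x).

Lemma continuous_cosX_expR n b : continuous (W n b).
Proof.
move=> x; apply: cvgM; last exact: continuous_expRZ.
by apply: (@continuous_comp _ _ _ cos (fun y => y ^+ n));
  [exact: continuous_cos|exact: exprn_continuous].
Qed.

Lemma is_derive_expRZ b x :
  is_derive x 1 (fun y => expR (b * y)) (b * expR (b * x)).
Proof.
by apply: is_derive_eq; rewrite /GRing.scale/= mulr1 mulrC.
Qed.

Lemma is_derive_cosX n x :
  is_derive x 1 (fun y => cos y ^+ n) (- n%:R * cos x ^+ n.-1 * sin x).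
Proof.
have -> : (fun y => cos y ^+ n) = @cos R ^+ n by rewrite exprfctE.
by apply: is_derive_eq; rewrite /GRing.scale/=; ring.
Qed.

Lemma pihalf_ge0 : - (pi / 2) <= pi / 2 :> R.
Proof. by rewrite ge0_cp// divr_ge0// pi_ge0. Qed.

Lemma cos_moment_rec n b :
  (b ^+ 2 + n.+2%:R ^+ 2) * cos_moment n.+2 b =
  n.+2%:R * n.+1%:R * cos_moment n b.
Proof.
(* [F] collects the boundary terms of the two integrations by parts. *)
pose F x :=
  expR (b * x) * (b * cos x ^+ n.+2 + n.+2%:R * (cos x ^+ n.+1 * sin x)).
pose f x := (b ^+ 2 + n.+2%:R ^+ 2) * W n.+2 b x - n.+2%:R * n.+1%:R * W n b x.
have cf : continuous f.
  by move=> x; apply: cvgB; apply: cvgMr; exact: continuous_cosX_expR.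
have dF x : is_derive x 1 F (f x).
  have d1 := is_derive_cosX n.+1 x; have d2 := is_derive_cosX n.+2 x.
  rewrite /F; apply: is_derive_eq; rewrite /GRing.scale/= /f /W.
  (* The factor cos^2 + sin^2 = 1 is inserted by hand: what remains is a polynomial identity in cos,
     sin and exp. *)
  transitivity ((b ^+ 2 + n.+2%:R ^+ 2) * (cos x ^+ n.+2 * expR (b * x)) -
    n.+2%:R * n.+1%:R * (cos x ^+ n * expR (b * x)) *
    (cos x ^+ 2 + sin x ^+ 2)); last by rewrite cos2Dsin2 mulr1.
  rewrite !exprS -!natr1; ring.
have := continuous_Rintegral_itv pihalf_ge0 cf dF.
(* Each term of [F] contains a positive power of the cosine, hence vanishes at both endpoints. *)
rewrite /F cosN cos_pihalf !expr0n/= !mul0r !mulr0 !addr0 !mulr0 subrr.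
have intcW k c :
    leb.-integrable `[- (pi / 2), pi / 2] (EFin \o (fun x => c * W k b x)).
  apply: continuous_integrable_itv => x.
  by apply: cvgMr; exact: continuous_cosX_expR.
have intW k : leb.-integrable `[- (pi / 2), pi / 2] (EFin \o W k b).
  by apply: continuous_integrable_itv; exact: continuous_cosX_expR.
by rewrite RintegralB ?RintegralZl//; first by move/subr0_eq.
Qed.

(** The primitive [F] is explicit for every [b]. The sine has opposite signs at the two endpoints,
    so the exponentials add up to a cosh. *)
Lemma cos_moment1 b : cos_moment 1 b = 2 * cosh (b * (pi / 2)) / (b ^+ 2 + 1).
Proof.
have b1 : b ^+ 2 + 1 != 0 by rewrite gt_eqF// ltr_wpDl// sqr_ge0.
pose F x := expR (b * x) * (b * cos x + sin x) * (b ^+ 2 + 1)^-1.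
have dF x : is_derive x 1 F (W 1 b x).
  rewrite /F; apply: is_derive_eq; rewrite /GRing.scale/= /W expr1.
  by field.
rewrite /cos_moment (continuous_Rintegral_itv pihalf_ge0 _ dF)//; last first.
  exact: continuous_cosX_expR.
rewrite /F cosN sinN cos_pihalf sin_pihalf /cosh mulrN.
by field.
Qed.

Lemma cos_moment0 b : b != 0 -> cos_moment 0 b = 2 * sinh (b * (pi / 2)) / b.
Proof.
move=> b0; pose F x := b^-1 * expR (b * x).
have dF x : is_derive x 1 F (W 0 b x).
  by rewrite /F; apply: is_derive_eq; rewrite /GRing.scale/= /W expr0; field.
rewrite /cos_moment (continuous_Rintegral_itv pihalf_ge0 _ dF)//; last first.
  exact: continuous_cosX_expR.
rewrite /F /sinh mulrN.
by field.
Qed.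

(** The case b = 0, excluded by the division in [cos_moment0]; it supplies the limit value when mu =
    0. *)
Lemma cos_moment00 : cos_moment 0 0 = pi.
Proof.
have dF x : is_derive x 1 (id : R -> R) (W 0 0 x).
  by rewrite /W expr0 mul0r expR0 mulr1; exact: is_derive_id.
rewrite /cos_moment (continuous_Rintegral_itv pihalf_ge0 _ dF).
  by field.
exact: continuous_cosX_expR.
Qed.

(** Keeping [cos_moment 0 b] as a factor, instead of its sinh form, makes the formula valid at b = 0
    too. *)
Lemma cos_moment_even m b :
  cos_moment (2 * m) b =
  ((2 * m)`!)%:R / \prod_(1 <= k < m.+1) (b ^+ 2 + (2 * k%:R) ^+ 2) *
  cos_moment 0 b.
Proof.
elim: m => [|m IH]; first by rewrite muln0 big_nil fact0 divr1 mul1r.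
rewrite big_nat_recr//= mulnS add2n.
have k0 : b ^+ 2 + (2 * m.+1%:R) ^+ 2 != 0.
  by rewrite gt_eqF// ltr_wpDl ?sqr_ge0// exprn_gt0// mulr_gt0// ltr0n.
apply: (mulfI k0).
have k2 : 2 * m.+1%:R = (2 * m).+2%:R :> R by rewrite -natrM mulnS.
move: k0; rewrite k2 => k0; rewrite cos_moment_rec IH 2!factS 2!natrM invfM.
(* With the inverse product made opaque, [field] only has to know that the newest factor is
   nonzero. *)
move: (\prod_(1 <= k < m.+1) _)^-1 => P.
by move: k0; move: ((2 * m).+2%:R) => q k0; field.
Qed.

(** The product starts at k = 0 because the denominator b^2 + 1 of [cos_moment1] is its first
    factor. *)
Lemma cos_moment_odd m b :
  cos_moment (2 * m + 1) b =
  2 * ((2 * m + 1)`!)%:R /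
  \prod_(0 <= k < m.+1) (b ^+ 2 + (2 * k%:R + 1) ^+ 2) *
  cosh (b * (pi / 2)).
Proof.
elim: m => [|m IH].
  by rewrite big_nat1 muln0 add0n cos_moment1 mulr0 add0r expr1n mulr1 mulrAC.
rewrite big_nat_recr//= mulnS -addnA add2n.
have k2 : 2 * m.+1%:R + 1 = (2 * m + 1).+2%:R :> R.
  by rewrite -natrM mulnS natr1 addn1.
have k0 : b ^+ 2 + (2 * m + 1).+2%:R ^+ 2 != 0.
  by rewrite gt_eqF// ltr_wpDl ?sqr_ge0// exprn_gt0// ltr0n.
apply: (mulfI k0).
rewrite k2 cos_moment_rec IH 2!factS 2!natrM invfM.
move: (\prod_(0 <= k < m.+1) _)^-1 => P.
by move: k0; move: ((2 * m + 1).+2%:R) => q k0; field.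
Qed.

End moments.

Lemma trig_moment_natr (R : realType) (n : nat) (c : R) :
  trig_moment n%:R c = cos_moment n c.
Proof.
apply: eq_Rintegral => x /[!inE]/=; rewrite in_itv/= => xpi.
by rewrite powR_mulrn// cos_ge0_pihalf.
Qed.

(** On [0, 1 / 2], which lies inside [- pi / 2, pi / 2], the continuous weight attains a positive
    minimum; half of it bounds the moment from below. Positivity is what lets the logarithms be
    split later. *)
Lemma trig_moment_gt0 (R : realType) (r c : R) : 0 < r -> 0 < trig_moment r c.
Proof.
move=> r0; have cw := @continuous_trig_weight R r c r0.
have pi1 : 2^-1 < pi / 2 :> R by have := pihalf_ge1 R; lra.
have h0 : 0 <= 2^-1 :> R by rewrite invr_ge0 ler0n.
have [z z01 zmin] := @EVT_min R (trig_weight r c) 0 2^-1 h0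
  (@continuous_subspaceT _ _ _ _ cw).
have wz0 : 0 < trig_weight r c z.
  move: z01; rewrite in_itv/= => /andP[z0 z1].
  rewrite mulr_gt0 ?expR_gt0// powR_gt0// lt_max cos_gt0_pihalf//.
  by rewrite (lt_le_trans _ z0) ?oppr_lt0 ?divr_gt0 ?pi_gt0//= (le_lt_trans z1).
rewrite trig_moment_weight -lte_fin -continuous_integral_itv//.
apply: (@lt_le_trans _ _
    (\int[leb]_(x in `[0%R, (2^-1)%R]) (trig_weight r c z)%:E)%E).
  rewrite integral_cst//= lebesgue_measure_itv/= lte_fin invr_gt0 ltr0n.
  rewrite oppr0 adde0 -EFinM.
  by rewrite lte_fin mulr_gt0//.
apply: (@le_trans _ _
    (\int[leb]_(x in `[0%R, (2^-1)%R]) (trig_weight r c x)%:E)%E).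
  apply: ge0_le_integral => //.
  - by move=> x _; rewrite lee_fin ltW.
  - exact: continuous_measurable_EFin.
apply: ge0_subset_integral => //.
- exact: continuous_measurable_EFin.
- by move=> x _; rewrite lee_fin trig_weight_ge0.
- apply: subset_itv; rewrite bnd_simp ?ltW//.
  by rewrite oppr_lt0 divr_gt0 ?pi_gt0.
Qed.

(** * Normalization and Rényi information of the Pearson density *)

Lemma cos_exp_integralE (R : realType) (a mu : R) : 0 < a ->
  cos_exp_integral a mu = trig_moment a^-1 (mu / a).
Proof. by move=> a0; rewrite -trig_momentN// invr_gt0. Qed.

Lemma cos_exp_integral_gt0 (R : realType) (a mu : R) : 0 < a ->
  0 < cos_exp_integral a mu.
Proof.
by move=> a0; rewrite cos_exp_integralE// trig_moment_gt0// invr_gt0.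
Qed.

Lemma pearson_kernelE (R : realType) (a mu x : R) :
  pearson_kernel a mu x =
  (1 + x ^+ 2) `^ (- (a^-1 / 2) - 1) * expR (mu / a * atan x).
Proof. by rewrite /pearson_kernel invfM [2^-1 * _]mulrC. Qed.

Lemma pearson_kernel_ge0 (R : realType) (a mu x : R) :
  0 <= pearson_kernel a mu x.
Proof. by rewrite mulr_ge0 ?powR_ge0 ?expR_ge0. Qed.

Lemma continuous_pearson_kernel (R : realType) (a mu : R) : 0 < a ->
  continuous (pearson_kernel a mu).
Proof.
move=> a0; rewrite (_ : pearson_kernel a mu =
  fun x => trig_weight a^-1 (mu / a) (atan x) * (1 + x ^+ 2)^-1).
  apply: continuous_comp_atan.
  by apply: continuous_trig_weight; rewrite invr_gt0.
by apply/funext => x; rewrite pearson_kernelE powR_expR_atanE.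
Qed.

Lemma integral_pearson_kernel (R : realType) (a mu : R) : 0 < a ->
  (\int[leb]_x (pearson_kernel a mu x)%:E = (cos_exp_integral a mu)%:E)%E.
Proof.
move=> a0; under eq_integral do rewrite pearson_kernelE.
by rewrite integral_powR_expR_atan ?invr_gt0// cos_exp_integralE.
Qed.

Lemma pearson_densityE (R : realType) (a mu x : R) : 0 < a ->
  pearson_density a mu x = pearson_kernel a mu x / cos_exp_integral a mu.
Proof.
by move=> a0; rewrite /pearson_density /Rintegral integral_pearson_kernel.
Qed.

Lemma pearson_density_is_density (R : realType) (a mu : R) : 0 < a ->
  is_density (pearson_density a mu).
Proof.
move=> a0; have Z0 := cos_exp_integral_gt0 mu a0.
have ck := @continuous_pearson_kernel R a mu a0.
have fE : pearson_density a mu =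
    fun x => (cos_exp_integral a mu)^-1 * pearson_kernel a mu x.
  by apply/funext => x; rewrite pearson_densityE// mulrC.
rewrite fE; split.
- by apply: continuous_measurable_fun => x; apply: cvgMr; exact: ck.
- by move=> x; rewrite mulr_ge0 ?invr_ge0 ?(ltW Z0)// pearson_kernel_ge0.
- under eq_integral do rewrite EFinM.
  rewrite ge0_integralZl//=.
  + by rewrite integral_pearson_kernel// -EFinM mulVf// gt_eqF.
  + exact: continuous_measurable_EFin.
  + by move=> x _; rewrite lee_fin pearson_kernel_ge0.
  + by rewrite lee_fin invr_ge0 ltW.
Qed.

(** The power [alpha] of the density is a constant times a kernel of the same shape; the last
    hypothesis says that its exponent is - r / 2 - 1. *)
Lemma renyi_pearson_density (R : realType) (a mu alpha r : R) :
  0 < a -> 0 < r -> ((2 * a)^-1 + 1) * alpha = r / 2 + 1 ->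
  renyi alpha (pearson_density a mu) =
  ((1 - alpha)^-1 * (ln (trig_moment r (mu / a * alpha))
                     - alpha * ln (cos_exp_integral a mu)))%:E.
Proof.
move=> a0 r0 ralpha; have Z0 := cos_exp_integral_gt0 mu a0.
set Z := cos_exp_integral a mu; set c := mu / a * alpha.
have fE x : pearson_density a mu x `^ alpha =
    Z^-1 `^ alpha * ((1 + x ^+ 2) `^ (- (r / 2) - 1) * expR (c * atan x)).
  rewrite pearson_densityE// mulrC.
  rewrite powRM ?invr_ge0 ?(ltW Z0) ?pearson_kernel_ge0//.
  rewrite /pearson_kernel powRM ?powR_ge0 ?expR_ge0// -powRrM -expRM.
  congr (_ * (_ `^ _ * expR _)); last by rewrite /c mulrAC.
  by move: ralpha; lra.
rewrite /renyi; under eq_integral do rewrite fE EFinM.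
rewrite ge0_integralZl//=; last 3 first.
- apply: continuous_measurable_EFin.
  under eq_fun do rewrite powR_expR_atanE.
  by apply: continuous_comp_atan; exact: continuous_trig_weight.
- by move=> x _; rewrite lee_fin mulr_ge0 ?powR_ge0 ?expR_ge0.
- by rewrite lee_fin powR_ge0.
have J0 := @trig_moment_gt0 R r c r0.
have ZV0 : 0 < Z^-1 `^ alpha by rewrite powR_gt0// invr_gt0.
rewrite integral_powR_expR_atan// -EFinM lne_EFin ?mulr_gt0// -EFinM.
rewrite lnM ?posrE// ln_powR lnV ?posrE// mulrN.
by congr (_ * _)%:E; rewrite addrC.
Qed.

(** * The removable singularity at mu = 0, and the constants of the statement as moments *)

Lemma cos_moment0_cvg0 (R : realType) (k : R) : k != 0 ->
  cos_moment 0 (k * nu) @[nu --> (0:R)^'] --> cos_moment 0 (0 : R).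
Proof.
move=> k0; rewrite cos_moment00.
pose u := k * (pi / 2); pose f x := expR (u * x) - expR (- u * x).
pose df x := u * expR (u * x) + u * expR (- u * x).
have dfE (x : R) : is_derive x 1 f (df x).
  have d1 := is_derive_expRZ u x; have d2 := is_derive_expRZ (- u) x.
  by rewrite /f /df; apply: is_derive_eq; rewrite mulNr opprK.
have dgE (x : R) : is_derive x 1 (fun y : R => k * y) k.
  by apply: is_derive_eq; rewrite /GRing.scale/= mulr1.
have cdf : continuous df.
  by move=> x; apply: cvgD; apply: cvgMr; exact: continuous_expRZ.
apply: (@cvg_trans _ (f x / (k * x) @[x --> 0^'])).
  apply: near_eq_cvg; near=> x.
  have x0 : x != 0 by near: x; exact: nbhs_dnbhs_neq.
  rewrite cos_moment0 ?mulf_neq0// /f /sinh.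
  have -> : k * x * (pi / 2) = u * x by rewrite /u mulrAC.
  by rewrite mulNr; field; rewrite x0 k0.
(* L'Hôpital's rule at 0, with limit [df 0 / k] = 2 u / k = pi. *)
apply: (@lhopital R f df (fun y => k * y) (fun=> k) (-1) 1 0) => //.
- by rewrite in_itv/= ltrN10 ltr01.
- have := is_derive_continuous dfE (x := 0).
  by rewrite /continuous_at /f !mulr0 subrr.
- have := is_derive_continuous dgE (x := 0).
  by rewrite /continuous_at mulr0.
- have -> : pi = df 0 / k by rewrite /df !mulr0 expR0 /u; field.
  by apply: cvgM; [exact: cdf|exact: cvg_cst].
Unshelve. all: by end_near. Qed.

(** The limit passes through [cos_moment_rec], since the factor b^2 + n^2 is continuous in b and
    never zero for n >= 2. *)
Lemma cos_moment_even_cvg0 (R : realType) (m : nat) (k : R) : k != 0 ->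
  cos_moment (2 * m) (k * nu) @[nu --> (0:R)^'] --> cos_moment (2 * m) (0 : R).
Proof.
move=> k0; elim: m => [|m IH]; first by rewrite muln0; exact: cos_moment0_cvg0.
rewrite mulnS add2n; set n := (2 * m)%N in IH *.
have n0 x : x ^+ 2 + n.+2%:R ^+ 2 != 0 :> R.
  by rewrite gt_eqF// ltr_wpDl ?sqr_ge0// exprn_gt0// ltr0n.
have recE b : cos_moment n.+2 b =
    n.+2%:R * n.+1%:R * cos_moment n b * (b ^+ 2 + n.+2%:R ^+ 2)^-1 :> R.
  by rewrite -cos_moment_rec mulrAC divff ?mul1r.
rewrite recE; under eq_fun do rewrite recE.
apply: cvgM; first by apply: cvgMr; exact: IH.
apply: cvgV => //; apply: cvgD; last exact: cvg_cst.
apply: cvg_within_filter.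
have cX : continuous (fun nu : R => (k * nu) ^+ 2).
  move=> x; apply: (@continuous_comp _ _ _ ( *%R k) (fun y => y ^+ 2)).
    exact: mulrl_continuous.
  exact: exprn_continuous.
by have := cX 0; rewrite /continuous_at mulr0.
Qed.

(** The argument of sinh is [beta] times pi / 2, with [beta] as in [coefC]. At mu = 0 the left side
    would be 0 by the convention on division, unlike the moment. *)
Lemma C_sinhE (R : realType) (a : R) (m : nat) (mu : R) : 0 < a -> mu != 0 ->
  C_sinh a m mu = cos_moment (2 * m) (2 * (m%:R + 1) / (1 + 2 * a) * mu).
Proof.
move=> a0 mu0.
have a1 : 1 + 2 * a != 0 by rewrite gt_eqF// addr_gt0// mulr_gt0.
have m1 : m%:R + 1 != 0 :> R by rewrite natr1.
rewrite cos_moment_even cos_moment0 ?mulf_neq0 ?invr_eq0//.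
rewrite /C_sinh /Defs.coefC /= [2 * _ * mu / _]mulrAC.
set b := 2 * (m%:R + 1) / (1 + 2 * a) * mu.
have b0 : b != 0 by rewrite !mulf_neq0 ?invr_eq0.
have -> : (m%:R + 1) * mu / (1 + 2 * a) * pi = b * (pi / 2).
  by rewrite /b; field.
rewrite invfM; move: (\prod_(1 <= k < m.+1) _)^-1 (sinh _) => P S.
by field.
Qed.

Lemma D_coshE (R : realType) (a : R) (m : nat) (mu : R) : 0 < a ->
  D_cosh a m mu = cos_moment (2 * m + 1) ((2 * m%:R + 3) / (1 + 2 * a) * mu).
Proof.
move=> a0.
have a1 : 1 + 2 * a != 0 by rewrite gt_eqF// addr_gt0// mulr_gt0.
rewrite cos_moment_odd /D_cosh /Defs.coefD /= [(2 * _ + 3) * mu / _]mulrAC.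
by congr (_ * cosh _); field.
Qed.

(** * The Pearson density as an invariant density *)

Lemma oriented_integral_FTC (R : realType) (F f : R -> R) (x0 x : R) :
  continuous f -> (forall x : R, is_derive x 1 F (f x)) ->
  oriented_integral x0 x f = F x - F x0.
Proof.
move=> cf dF; rewrite /oriented_integral; case: ifPn => [x0x|].
  exact: continuous_Rintegral_itv.
rewrite -ltNge => /ltW xx0.
by rewrite (continuous_Rintegral_itv xx0 cf dF) opprB.
Qed.

Section pearson_diffusion.
Context {R : realType}.
Variables (theta a mu : R).
Hypotheses (theta0 : 0 < theta) (a0 : 0 < a).

(** A primitive of drift over squared diffusion coefficient, a ratio in which [theta] cancels. *)
Let G (x : R) : R := (2 * a)^-1 * (mu * atan x - 2^-1 * ln (1 + x ^+ 2)).

Lemma pearson_driftE (x : R) :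
  pearson_drift theta mu x / pearson_diffusion theta a x ^+ 2 =
  (2 * a)^-1 * (mu - x) * (1 + x ^+ 2)^-1.
Proof.
have x1 : 0 < 1 + x ^+ 2 by rewrite ltr_pwDl// sqr_ge0.
rewrite /pearson_diffusion sqr_sqrtr; last first.
  by rewrite [x ^+ 2 + 1]addrC !mulr_ge0// ltW.
rewrite /pearson_drift [x ^+ 2 + 1]addrC; move: x1; move: (1 + x ^+ 2) => q q0.
by field; rewrite !gt_eqF.
Qed.

Lemma pearson_scale_density (x0 x : R) :
  scale_density (pearson_drift theta mu) (pearson_diffusion theta a) x0 x =
  expR (- 2 * (G x - G x0)).
Proof.
have dG (y : R) : is_derive y 1 G ((2 * a)^-1 * (mu - y) * (1 + y ^+ 2)^-1).
  have y1 : 0 < 1 + y ^+ 2 by rewrite ltr_pwDl// sqr_ge0.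
  have dln : is_derive y 1 (fun y => ln (1 + y ^+ 2))
      ((1 + y ^+ 2)^-1 * (2 * y)).
    apply: (@is_derive1_comp _ (@ln R) (fun y => 1 + y ^+ 2)).
      exact: is_derive1_ln.
    by apply: is_derive_eq; rewrite /GRing.scale/=; ring.
  rewrite /G; apply: is_derive_eq; rewrite /GRing.scale/=.
  by field; rewrite !gt_eqF.
rewrite /scale_density; under eq_fun do rewrite pearson_driftE.
rewrite (oriented_integral_FTC _ _ _ dG)// => y.
apply: cvgM; last exact: continuous_inv1Dsqr.
by apply: cvgMr; apply: cvgB; [exact: cvg_cst|exact: cvg_id].
Qed.

(** exp (2 G) gives the power - 1 / (2 a) and the arctangent factor, and the squared diffusion
    coefficient gives the power - 1. Both [theta] and [x0] enter only through a constant, which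
    normalization cancels. *)
Lemma pearson_speed_density (x0 x : R) :
  speed_density (pearson_drift theta mu) (pearson_diffusion theta a) x0 x =
  (2 * theta * a)^-1 * expR (- 2 * G x0) * pearson_kernel a mu x.
Proof.
have x1 : 0 < 1 + x ^+ 2 by rewrite ltr_pwDl// sqr_ge0.
rewrite /speed_density pearson_scale_density /pearson_diffusion.
rewrite sqr_sqrtr; last first.
  by rewrite [x ^+ 2 + 1]addrC !mulr_ge0// ltW.
rewrite [x ^+ 2 + 1]addrC !invfM -expRN.
have -> : - (- 2 * (G x - G x0)) =
    - 2 * G x0 + (mu / a * atan x + - (2 * a)^-1 * ln (1 + x ^+ 2)).
  by rewrite /G; field; rewrite gt_eqF.
rewrite !expRD /pearson_kernel.
rewrite powRD; last by rewrite [1 + _ == 0]gt_eqF// implybT.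
rewrite powR_inv1 ?ltW// [X in _ = _ * (X * _ * _)]/powR gt_eqF//.
ring.
Qed.

Lemma pearson_invariant_density (x0 x : R) :
  invariant_density -oo%E +oo%E
    (pearson_drift theta mu) (pearson_diffusion theta a) x0 x
  = pearson_density a mu x.
Proof.
rewrite /invariant_density.
have -> : [set y : R | (-oo < y%:E < +oo)%E] = setT.
  by apply/seteqP; split => // y _; rewrite /= ltNyr ltry.
set K := (2 * theta * a)^-1 * expR (- 2 * G x0).
have K0 : 0 < K by rewrite mulr_gt0 ?expR_gt0// invr_gt0 !mulr_gt0.
rewrite pearson_speed_density -/K /Rintegral.
under eq_integral do rewrite pearson_speed_density -/K EFinM.
rewrite ge0_integralZl//=; last 3 first.
- by apply: continuous_measurable_EFin; exact: continuous_pearson_kernel.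
- by move=> y _; rewrite lee_fin pearson_kernel_ge0.
- by rewrite lee_fin ltW.
rewrite integral_pearson_kernel//= pearson_densityE//.
by field; rewrite !gt_eqF// cos_exp_integral_gt0.
Qed.

End pearson_diffusion.

Theorem theorem3p1 (R : realType) (a mu : R) (ha : 0 < a) :
  (* the density f, and its description as an invariant density *)
  is_density (pearson_density a mu) /\
  (forall theta x0 x : R, 0 < theta ->
     invariant_density -oo%E +oo%E
       (pearson_drift theta mu) (pearson_diffusion theta a) x0 x
     = pearson_density a mu x) /\
  (* (i) for mu != 0 *)
  (forall m : nat, (1 <= m)%N ->
     2 * a * (m%:R + 1) / (1 + 2 * a) != 1 -> mu != 0 ->
     renyi (2 * a * (m%:R + 1) / (1 + 2 * a)) (pearson_density a mu)
     = (2 * a * (m%:R + 1) / (2 * a * m%:R - 1) * ln (cos_exp_integral a mu)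
        + (1 + 2 * a) / (1 - 2 * a * m%:R) * ln (C_sinh a m mu))%:E) /\
  (* (i) for mu = 0, the removable singularity being filled by the limit *)
  (forall m : nat, (1 <= m)%N ->
     2 * a * (m%:R + 1) / (1 + 2 * a) != 1 -> mu = 0 ->
     exists2 L : R, C_sinh a m nu @[nu --> 0^'] --> L &
     renyi (2 * a * (m%:R + 1) / (1 + 2 * a)) (pearson_density a mu)
     = (2 * a * (m%:R + 1) / (2 * a * m%:R - 1) * ln (cos_exp_integral a mu)
        + (1 + 2 * a) / (1 - 2 * a * m%:R) * ln L)%:E) /\
  (* (ii) *)
  (forall m : nat, (1 <= m)%N ->
     2 * a * (m%:R + 3 / 2) / (1 + 2 * a) != 1 ->
     renyi (2 * a * (m%:R + 3 / 2) / (1 + 2 * a)) (pearson_density a mu)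
     = (a * (2 * m%:R + 3) / (a * (2 * m%:R + 1) - 1)
          * ln (cos_exp_integral a mu)
        + (1 + 2 * a) / (1 - a * (2 * m%:R + 1)) * ln (D_cosh a m mu))%:E).
Proof.
have a1 : 1 + 2 * a != 0 by rewrite gt_eqF// addr_gt0// mulr_gt0.
(* Formula (i) with the moment itself in place of [C_sinh]: it holds for every [mu] and serves both
   cases of (i). *)
have Heven m : (1 <= m)%N -> 2 * a * (m%:R + 1) / (1 + 2 * a) != 1 ->
    renyi (2 * a * (m%:R + 1) / (1 + 2 * a)) (pearson_density a mu)
    = (2 * a * (m%:R + 1) / (2 * a * m%:R - 1) * ln (cos_exp_integral a mu)
       + (1 + 2 * a) / (1 - 2 * a * m%:R) *
         ln (cos_moment (2 * m) (2 * (m%:R + 1) / (1 + 2 * a) * mu)))%:E.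
  move=> m1 al1; have r0 : 0 < (2 * m)%:R :> R by rewrite ltr0n muln_gt0.
  rewrite (renyi_pearson_density _ ha r0); last first.
    by rewrite natrM; field; rewrite a1 gt_eqF.
  (* Since 1 - alpha = (1 - 2 a m) / (1 + 2 a), this is the condition alpha != 1. *)
  have am : 1 - 2 * a * m%:R != 0.
    apply: contra al1; rewrite subr_eq0 => /eqP am.
    by apply/eqP; rewrite mulrDr mulr1 -am divff.
  have -> : mu / a * (2 * a * (m%:R + 1) / (1 + 2 * a)) =
      2 * (m%:R + 1) / (1 + 2 * a) * mu by field; rewrite a1 gt_eqF.
  rewrite trig_moment_natr; congr EFin.
  move: (ln _) (ln _) => u v; field.
  by rewrite am a1 andbT -oppr_eq0 opprB.
split; first exact: pearson_density_is_density.
split; first by move=> *; exact: pearson_invariant_density.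
split; first by move=> m m1 al1 mu0; rewrite Heven// C_sinhE.
split.
  (* For nu != 0, [C_sinh] equals the moment, so its limit is the moment at b = 0. *)
  move=> m m1 al1 mu0; exists (cos_moment (2 * m) 0); last first.
    by rewrite (Heven m m1 al1) mu0 mulr0.
  have k0 : 2 * (m%:R + 1) / (1 + 2 * a) != 0 :> R.
    by rewrite !mulf_neq0 ?invr_eq0// natr1.
  apply: cvg_trans (@cos_moment_even_cvg0 _ m _ k0); apply: near_eq_cvg.
  near=> nu; rewrite C_sinhE//; near: nu; exact: nbhs_dnbhs_neq.
move=> m m1 al1.
have r0 : 0 < (2 * m + 1)%:R :> R by rewrite ltr0n addn1.
rewrite (renyi_pearson_density _ ha r0); last first.
  by rewrite natrD natrM; field; rewrite a1 gt_eqF.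
(* Here 1 - alpha = (1 - a (2 m + 1)) / (1 + 2 a). *)
have am : 1 - a * (2 * m%:R + 1) != 0.
  apply: contra al1; rewrite subr_eq0 => /eqP am.
  apply/eqP; apply: (mulIf a1); rewrite mul1r divfK//.
  by move: am; lra.
have -> : mu / a * (2 * a * (m%:R + 3 / 2) / (1 + 2 * a)) =
    (2 * m%:R + 3) / (1 + 2 * a) * mu by field; rewrite a1 gt_eqF.
rewrite trig_moment_natr D_coshE//; congr EFin.
move: (ln _) (ln _) => u v; field.
by rewrite am a1 andbT -oppr_eq0 opprB.
Unshelve. all: by end_near. Qed.
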